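(* Let $K\ge1$, let $\mathcal N\subseteq\mathcal K=\{1,\dots,K\}$ be the set of indices of true null hypotheses and $K_0=|\mathcal N|$. Suppose that the raw e-values $E_1,\dots,E_K$ are PRDS. Applied to arbitrary non-negative random variables $E'_1,\dots,E'_K$ and $\alpha\in(0,1)$, the base e-BH procedure $\mathcal G(\alpha)$ satisfies $$\mathbb E\left[\frac{F_{\mathcal G(\alpha)}}{R_{\mathcal G(\alpha)}}\right]\le\frac{K_0}{K}z_\alpha,\qquad\text{where}\qquad z_\alpha=\frac1{K_0}\sum_{k\in\mathcal N}\max_{x\in K/\mathcal K}x\,\mathbb P(\alpha E'_k\ge x).$$ In particular, if $E'_1,\dots,E'_K$ are the raw e-values, or the boosted e-values (in the PRDS sense, either by boosting factors or by boosting functions, as defined in the context), then $z_\alpha\le\alpha$.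
   Context: There are $K$ hypotheses $H_1,\dots,H_K$, and $\mathbb P$ is the true data-generating probability measure; $H_k$ is a set of probability measures and is a true null if $\mathbb P\in H_k$, i.e. $k\in\mathcal N$. $K/\mathcal K:=\{K/k:k\in\mathcal K\}$. The raw e-values are $[0,\infty]$-valued random variables $E_1,\dots,E_K$, with $E_k$ associated to $H_k$, such that $\mathbb E[E_k]\le1$ for $k\in\mathcal N$. ''Increasing'' and ''decreasing'' are in the non-strict sense. PRDS: a set $A\subseteq\mathbb R^K$ is decreasing if $\mathbf x\in A$ implies $\mathbf y\in A$ for all $\mathbf y\le\mathbf x$ (componentwise). The random vector $\mathbf E=(E_1,\dots,E_K)$ is PRDS (positive regression dependent on the subset $\mathcal N$) if for every $k\in\mathcal N$ and every decreasing set $A\subseteq\mathbb R^K$, the function $x\mapsto\mathbb P(\mathbf E\in A\mid E_k\ge x)$ is decreasing on $[0,\infty)$. Base e-BH procedure $\mathcal G(\alpha)$: given inputs $e'_1,\dots,e'_K\in[0,\infty]$ with order statistics $e'_{[1]}\ge\dots\ge e'_{[K]}$, let $k_e^*=\max\{k\in\mathcal K:k e'_{[k]}/K\ge1/\alpha\}$ with $\max(\varnothing)=0$, and reject the hypotheses with the $k_e^*$ largest inputs. $R_{\mathcal G(\alpha)}$ is the number of rejected hypotheses, $F_{\mathcal G(\alpha)}$ is the number of rejected hypotheses with index in $\mathcal N$, and $0/0=0$. Boosted e-values (PRDS case): either $E'_k=b_kE_k$, where the boosting factor $b_k\ge1$ satisfies $\max_{x\in K/\mathcal K}x\,\mathbb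 P(\alpha b_kE_k\ge x)\le\alpha$ for each $k\in\mathcal K$; or, more generally, $E'_k=\phi_k(E_k)$, where $\phi_1,\dots,\phi_K:[0,\infty]\to[0,\infty]$ are increasing functions satisfying $\max_{x\in K/\mathcal K}x\,\mathbb P(\alpha\phi_k(E_k)\ge x)\le\alpha$ for each $k\in\mathcal K$. In these boosting conditions the probability is computed under the null distribution of $E_k$ (for a composite null, the condition must hold for all probability measures in $H_k$).
   Formalization: The FDR bound fails for arbitrary E' under PRDS raw e-values; it is stated for E' that are themselves PRDS or are increasing functions E'_k = φ_k(E_k) of the PRDS raw e-values, with decreasing sets in PRDS taken in the extended reals, as e-values may be infinite. *)

(* Defs.v *)
From HB Require Import structures.
From mathcomp Require Import all_boot all_order all_algebra.
From mathcomp Require Import all_classical all_reals all_analysis measurable_realfun.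
Set Implicit Arguments.
Unset Strict Implicit.
Unset Printing Implicit Defensive.
Import Order.TTheory GRing.Theory Num.Theory.
Local Open Scope classical_set_scope.
Local Open Scope ring_scope.

(** The hypothesis numbered k in {1, ..., K} is the ordinal
    of value k - 1 in ['I_K]; e-values take values in [0, +oo], a part of
    [\bar R].  [fine] is only applied to probabilities, which are finite. *)

Section eBH.
Variables (R : realType) (K : nat).
Implicit Types (e : 'I_K -> \bar R) (alpha : R).

Definition ebh_order e : seq 'I_K :=
  sort (fun i j => (e j <= e i)%E) (enum 'I_K).

(** e_[k] for 1 <= k <= K, with e_[1] >= ... >= e_[K]. *)
Definition order_stat e (k : nat) : \bar R :=
  nth 0%E [seq e i | i <- ebh_order e] k.-1.

Definition ebh_kstar alpha e : nat :=
  (\max_(i < K | ((alpha^-1)%:E <=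
      (i.+1)%:R%:E * order_stat e i.+1 * (K%:R^-1)%:E)%E) i.+1)%N.

(** How [sort] breaks ties is immaterial: if k* = [ebh_kstar alpha e] and
    0 < k* < K, then e_[k*+1] < e_[k*] by maximality of k*. *)
Definition ebh_rejected alpha e : {set 'I_K} :=
  [set k in take (ebh_kstar alpha e) (ebh_order e)].

(** Division by 0 being 0, this is 0 when nothing is rejected. *)
Definition ebh_fdp (N : {set 'I_K}) alpha e : R :=
  #|ebh_rejected alpha e :&: N|%:R / #|ebh_rejected alpha e|%:R.

End eBH.

Section PRDS.
Context (d : measure_display) (T : measurableType d) (R : realType).
Variables (P : probability T R) (K : nat).

Definition cond_prob (A B : set T) : R := fine (P (A `&` B)) / fine (P B).

Definition decreasing_set (A : set (K.-tuple (\bar R))) : Prop :=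
  forall x y, A x -> (forall i, (tnth y i <= tnth x i)%E) -> A y.

(** The decreasing sets live in [\bar R]^K because the e-values may be infinite;
    for finite-valued e-values, decreasing subsets of R^K give the same
    condition.  Only Borel sets are considered, so that [E \in A] is an event.
    When [P (X k >= y) = 0] the value at [y] is 0 by the division convention;
    this adds no constraint, as the events [X k >= y] shrink as [y] grows. *)
Definition PRDS (N : {set 'I_K}) (X : 'I_K -> T -> \bar R) : Prop :=
  forall k, k \in N ->
  forall A : set (K.-tuple (\bar R)), measurable A -> decreasing_set A ->
  forall x y : R, 0 <= x -> x <= y ->
    cond_prob [set w | A [tuple X i w | i < K]] [set w | (y%:E <= X k w)%E] <=
    cond_prob [set w | A [tuple X i w | i < K]] [set w | (x%:E <= X k w)%E].

End PRDS.

Section boosting.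
Context (d : measure_display) (T : measurableType d) (R : realType).
Variable (K : nat).
Implicit Types (P : probability T R) (alpha : R) (H : 'I_K -> set (probability T R)).

(** The maximum over x in {K/1, ..., K/K} of x P(alpha X >= x); the terms are
    nonnegative, so starting the iteration at 0 does not change the maximum. *)
Definition max_tail P alpha (X : T -> \bar R) : R :=
  \big[Order.max/0]_(i < K)
    (K%:R / i.+1%:R *
     fine (P [set w | ((K%:R / i.+1%:R)%:E <= alpha%:E * X w)%E])).

(** For [N] empty this is 0. *)
Definition z_alpha P (N : {set 'I_K}) alpha (X : 'I_K -> T -> \bar R) : R :=
  #|N|%:R^-1 * \sum_(k in N) max_tail P alpha (X k).

Definition increasing_nneg (phi : \bar R -> \bar R) : Prop :=
  (forall x, (0 <= x)%E -> (0 <= phi x)%E) /\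
  (forall x y, (0 <= x)%E -> (x <= y)%E -> (phi x <= phi y)%E).

(** [X k] is the image of [E k] under an increasing function from [0, +oo] to
    itself; values of [phi k] outside [0, +oo] play no role. *)
Definition increasing_transform (E X : 'I_K -> T -> \bar R) : Prop :=
  exists phi : 'I_K -> \bar R -> \bar R,
    (forall k, increasing_nneg (phi k)) /\
    (forall k w, X k w = phi k (E k w)).

(** The boosting condition for every null distribution, simple or composite. *)
Definition boosting_condition H alpha (X : 'I_K -> T -> \bar R) : Prop :=
  forall k (Q : probability T R), H k Q -> max_tail Q alpha (X k) <= alpha.

Definition boosted_by_factors H alpha (E X : 'I_K -> T -> \bar R) : Prop :=
  (exists b : 'I_K -> R,
     (forall k, 1 <= b k) /\ (forall k w, X k w = ((b k)%:E * E k w)%E)) /\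
  boosting_condition H alpha X.

Definition boosted_by_functions H alpha (E X : 'I_K -> T -> \bar R) : Prop :=
  increasing_transform E X /\ boosting_condition H alpha X.

End boosting.

(* Main.v *)
(** Put t_r = K / (alpha r) and let R be the number of rejections.  Hypothesis k
    is rejected when R = r exactly if E'_k >= t_r, so the FDP is the sum over null k
    and r >= 1 of 1/r times the indicator of (R = r and E'_k >= t_r).  Since R is
    increasing in the e-values, D_r = (R <= r) is the preimage of a decreasing set.
    With c(r, s) = P(D_s | E'_k >= t_r),
      P(R = r, E'_k >= t_r) / r = P(E'_k >= t_r) / r * (c(r, r) - c(r, r - 1)),
    where P(E'_k >= t_r) / r is at most 1/K times the maximal tail of k.  PRDS gives
    c(r, s) <= c(r + 1, s), so the differences telescope to at most 1.

    For E'_k = phi_k(E_k), the event E'_k >= t is of the form E_k >= x or E_k > x;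
    conditioning on the latter is a limit of conditioning on the former. *)
Require Import Defs.
From HB Require Import structures.
From mathcomp Require Import all_boot all_order all_algebra.
From mathcomp Require Import all_classical all_reals all_analysis measurable_realfun.
Import Order.TTheory GRing.Theory Num.Theory.
Import numFieldNormedType.Exports.
Local Open Scope classical_set_scope.
Local Open Scope ring_scope.

(** In a non-increasing sequence the entries that are at least [c] form a prefix, and the count is
    its length. *)
Lemma ge_nth_sorted {disp : Order.disp_t} {T : orderType disp} (x0 c : T)
    (s : seq T) (i : nat) :
  sorted (fun x y => (y <= x)%O) s -> (i < size s)%N ->
  (c <= nth x0 s i)%O = (i < count (fun x => (c <= x)%O) s)%N.
Proof.
elim: s i => [//|a s IHs] i /= s_sorted.
have tr : transitive (fun x y : T => (y <= x)%O).
  by move=> y x z yx zy; exact: le_trans zy yx.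
have s_le := order_path_min tr s_sorted.
case: (boolP (c <= a)%O) => ca.
  by case: i => [|i] //=; rewrite ltnS => ?; rewrite IHs ?(path_sorted s_sorted).
have lt_c x : x \in a :: s -> (x < c)%O.
  rewrite inE => /predU1P[->|/(allP s_le) xa]; first by rewrite ltNge.
  by apply: le_lt_trans xa _; rewrite ltNge.
have -> : count (fun x => (c <= x)%O) s = 0%N.
  apply/eqP; rewrite eqn0Ngt -has_count; apply/hasPn => x xs.
  by rewrite -ltNge lt_c// inE xs orbT.
by move=> lti; rewrite leNgt lt_c// mem_nth.
Qed.

(** This is t_r. At [r = 0] it has the default value 0, so it decreases in [r] only from 1 on. *)
Definition ebh_threshold {R : realType} (K : nat) (alpha : R) (r : nat) : R :=
  K%:R / r%:R / alpha.

(** * The e-BH procedure on fixed inputs *)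

Section eBH_combinatorics.
Context {R : realType} {K : nat}.
Implicit Types (e : 'I_K -> \bar R) (alpha : R).

(** Counts replace sorting: their monotonicity in the inputs and their measurability are direct. *)
Definition count_ge e (c : R) : nat := #|[set k | (c%:E <= e k)%E]%SET|.

Lemma le_ebh_threshold alpha (r s : nat) : 0 < alpha -> (0 < r)%N -> (r <= s)%N ->
  ebh_threshold K alpha s <= ebh_threshold K alpha r.
Proof.
move=> a0 r0 rs; rewrite ler_pM2r ?invr_gt0// ler_wpM2l// lef_pV2 ?ler_nat//.
  by rewrite posrE ltr0n (leq_trans r0).
by rewrite posrE ltr0n.
Qed.

Lemma le_ebh_threshold_mul alpha (r : nat) (x : \bar R) : 0 < alpha ->
  ((ebh_threshold K alpha r)%:E <= x)%E = ((K%:R / r%:R)%:E <= alpha%:E * x)%E.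
Proof. by move=> a0; rewrite /ebh_threshold mulrC EFinM lee_pdivrMl. Qed.

Lemma count_geS e (c c' : R) : c <= c' -> (count_ge e c' <= count_ge e c)%N.
Proof.
move=> cc'; apply/subset_leq_card/fintype.subsetP => k; rewrite !inE.
by apply: le_trans; rewrite lee_fin.
Qed.

Lemma le_count_ge e e' (c : R) : (forall k, (e k <= e' k)%E) ->
  (count_ge e c <= count_ge e' c)%N.
Proof.
move=> ee'; apply/subset_leq_card/fintype.subsetP => k; rewrite !inE.
by move=> /le_trans; apply.
Qed.

Lemma perm_ebh_order e : perm_eq (ebh_order e) (enum 'I_K).
Proof. by rewrite perm_sort. Qed.

Lemma size_ebh_order e : size (ebh_order e) = K.
Proof. by rewrite (perm_size (perm_ebh_order e)) size_enum_ord. Qed.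

Lemma ge_order_stat e (c : R) (i : nat) : (i < K)%N ->
  (c%:E <= order_stat e i.+1)%E = (i < count_ge e c)%N.
Proof.
move=> iK; rewrite /order_stat ge_nth_sorted; last 2 first.
- rewrite sorted_map; apply: sort_sorted => x y /=.
  exact: le_total.
- by rewrite size_map size_ebh_order.
rewrite count_map (permP (perm_ebh_order e)) -size_filter /count_ge.
set s := seq.filter _ _; have us : uniq s by rewrite filter_uniq ?enum_uniq.
rewrite -(card_uniqP us); congr (leq _ _).
by apply: eq_card => k; rewrite mem_filter mem_enum inE andbT.
Qed.

Lemma ebh_crit alpha e (i : nat) : 0 < alpha -> (i < K)%N ->
  ((alpha^-1)%:E <= i.+1%:R%:E * order_stat e i.+1 * (K%:R^-1)%:E)%E =
  (i < count_ge e (ebh_threshold K alpha i.+1))%N.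
Proof.
move=> a0 iK; rewrite -ge_order_stat//.
have K0 : (0 : R) < K%:R by rewrite ltr0n (leq_ltn_trans _ iK).
rewrite lee_pdivlMr// -EFinM -lee_pdivrMl// -EFinM /ebh_threshold.
by congr (_%:E <= _)%E; rewrite [LHS]mulrA mulrC mulrA.
Qed.

(** The index [i] stands for the candidate [i.+1], so every candidate above [r] must fail its test.
    Monotonicity and measurability of [ebh_kstar] are read off from this form. *)
Lemma ebh_kstar_leP alpha e (r : nat) : 0 < alpha ->
  reflect (forall i : 'I_K, (r <= i)%N ->
             (count_ge e (ebh_threshold K alpha i.+1) <= i)%N)
          (ebh_kstar alpha e <= r)%N.
Proof.
move=> a0; apply: (iffP (bigmax_leqP _ _ _)) => [h i ri|h i].
  rewrite leqNgt; apply/negP; rewrite -ebh_crit// => /h.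
  by rewrite ltnNge ri.
by rewrite ebh_crit// ltnNge; apply: contraR; rewrite -leqNgt => /h.
Qed.

Lemma le_ebh_kstar alpha e e' : 0 < alpha -> (forall k, (e k <= e' k)%E) ->
  (ebh_kstar alpha e <= ebh_kstar alpha e')%N.
Proof.
move=> a0 ee'; apply/(ebh_kstar_leP _ _ _ a0) => i ki.
have /(ebh_kstar_leP _ _ _ a0)/(_ i ki) := leqnn (ebh_kstar alpha e').
exact/leq_trans/le_count_ge.
Qed.

Lemma ebh_kstar_le alpha e : (ebh_kstar alpha e <= K)%N.
Proof. by apply/bigmax_leqP. Qed.

Lemma card_ebh_rejected alpha e : #|ebh_rejected alpha e| = ebh_kstar alpha e.
Proof.
rewrite cardsE (card_uniqP _) ?take_uniq ?size_takel//.
  by rewrite size_ebh_order ebh_kstar_le.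
by rewrite (perm_uniq (perm_ebh_order e)) enum_uniq.
Qed.

(** Upper bound: below [K], the next candidate fails, although its threshold is no higher and so is
    reached by at least as many inputs. Lower bound: otherwise the maximal candidate would itself
    fail. *)
Lemma ebh_kstar_count alpha e : 0 < alpha -> (0 < ebh_kstar alpha e)%N ->
  count_ge e (ebh_threshold K alpha (ebh_kstar alpha e)) = ebh_kstar alpha e.
Proof.
move=> a0 k0; set r := ebh_kstar alpha e; apply/eqP; rewrite eqn_leq.
have rK : (r <= K)%N := ebh_kstar_le alpha e.
apply/andP; split.
  move: rK; rewrite leq_eqVlt => /predU1P[rK|rK].
    by apply: leq_trans (max_card _) _; rewrite card_ord rK.
  have /(ebh_kstar_leP _ _ _ a0)/(_ (Ordinal rK) (leqnn r)) := leqnn r.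
  exact/leq_trans/count_geS/le_ebh_threshold.
rewrite leqNgt; apply/negP => lt_count.
have : (r <= r.-1)%N.
  apply/(ebh_kstar_leP _ _ _ a0) => i; rewrite leq_eqVlt => /predU1P[ri|ri].
    by rewrite -ri prednK// -ltnS prednK.
  have /(ebh_kstar_leP _ _ _ a0)/(_ i) := leqnn r; apply.
  by move: ri; rewrite prednK.
by rewrite -ltnS prednK ?ltnn.
Qed.

(** Both sets have [ebh_kstar alpha e] elements, so one inclusion suffices: an input taken from the
    sorted list is at least the last one taken, which reaches the threshold. *)
Lemma ebh_rejectedE alpha e : 0 < alpha -> (0 < ebh_kstar alpha e)%N ->
  ebh_rejected alpha e =
  [set k | ((ebh_threshold K alpha (ebh_kstar alpha e))%:E <= e k)%E]%SET.
Proof.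
move=> a0 k0; apply/eqP; rewrite eqEcard card_ebh_rejected.
rewrite [X in (X <= _)%N](ebh_kstar_count _ _ a0 k0) leqnn andbT.
set r := ebh_kstar alpha e; have rK : (r <= K)%N := ebh_kstar_le alpha e.
have rK1 : (r.-1 < K)%N by rewrite prednK.
apply/fintype.subsetP => k; rewrite !inE => /(nthP k) [j].
rewrite size_takel ?size_ebh_order// => jr; rewrite nth_take// => <-.
have : ((ebh_threshold K alpha r)%:E <= order_stat e r.-1.+1)%E.
  by rewrite ge_order_stat// prednK// ebh_kstar_count.
move/le_trans; apply; rewrite /order_stat /= (nth_map k) ?size_ebh_order//.
have tr : transitive (fun i j => (e j <= e i)%E).
  by move=> y x z yx zy; exact: le_trans zy yx.
have rfl : reflexive (fun i j => (e j <= e i)%E) by move=> x /=.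
have tot : total (fun i j => (e j <= e i)%E) by move=> x y; exact: le_total.
apply: (sorted_leq_nth tr rfl k (sort_sorted tot (enum 'I_K))).
- by rewrite inE size_ebh_order (leq_trans jr).
- by rewrite inE size_ebh_order.
- by rewrite -ltnS prednK.
Qed.

(** Each rejected null contributes the inverse of the number of rejections, and the inner sum
    singles out that number. Without rejections both sides are 0. *)
Lemma ebh_fdpE (N : {set 'I_K}) alpha e : 0 < alpha ->
  ebh_fdp N alpha e = \sum_(k in N) \sum_(i < K) i.+1%:R^-1 *
    ((ebh_kstar alpha e == i.+1) &&
     ((ebh_threshold K alpha i.+1)%:E <= e k)%E)%:R.
Proof.
move=> a0; rewrite /ebh_fdp card_ebh_rejected.
have [r0|r_gt0] := posnP (ebh_kstar alpha e).
  rewrite r0 invr0 mulr0 big1// => k _; rewrite big1// => i _.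
  by rewrite mulr0.
rewrite ebh_rejectedE//; set r := ebh_kstar alpha e in r_gt0 *.
have rK : (r.-1 < K)%N by rewrite prednK// ebh_kstar_le.
rewrite finset.setIC -sum1_card natr_sum mulr_suml.
rewrite (eq_bigl (fun k => (k \in N) &&
    ((ebh_threshold K alpha r)%:E <= e k)%E)) => [|k]; last by rewrite !inE.
rewrite big_mkcondr; apply: eq_bigr => k _.
rewrite (bigD1 (Ordinal rK))//= prednK// eqxx big1 ?addr0.
  by case: ifP; rewrite ?mulr1 ?mul1r ?mulr0.
move=> i; rewrite -val_eqE /= => ir; rewrite (_ : (r == i.+1) = false) ?mulr0//.
by apply/negbTE; apply: contra ir => /eqP ->.
Qed.

(** More than [r] inputs reach [c] exactly when all inputs in some [S] with [r < #|S|] do, which is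
    a finite union of finite intersections. *)
Lemma measurable_count_ge d (T : measurableType d) (f : 'I_K -> T -> \bar R)
    (c : R) (r : nat) :
  (forall k, measurable [set w | (c%:E <= f k w)%E]) ->
  measurable [set w | (count_ge (fun k => f k w) c <= r)%N].
Proof.
move=> mf; rewrite (_ : [set w | _] = ~` \bigcup_(S in [set S : {set 'I_K} |
    (r < #|S|)%N]) \bigcap_(k in [set k | k \in S]) [set w | (c%:E <= f k w)%E]).
  apply/measurableC/fin_bigcup_measurable => [|S _]; first exact: finite_finset.
  by apply: fin_bigcap_measurable => //; exact: finite_finset.
apply/seteqP; split => w /= => [le_r [S /= rS Sw]|nS].
  have : (#|S| <= r)%N.
    apply: leq_trans le_r; apply/subset_leq_card/fintype.subsetP => k kS.
    by rewrite inE; exact: Sw.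
  by rewrite leqNgt rS.
rewrite leqNgt; apply/negP => lt_r; apply: nS.
by eexists; [exact: lt_r|move=> k /=; rewrite inE].
Qed.

Lemma measurable_ebh_kstar_le d (T : measurableType d) (f : 'I_K -> T -> \bar R)
    alpha (r : nat) : 0 < alpha ->
  (forall k (c : R), measurable [set w | (c%:E <= f k w)%E]) ->
  measurable [set w | (ebh_kstar alpha (fun k => f k w) <= r)%N].
Proof.
move=> a0 mf; rewrite (_ : [set w | _] = \bigcap_(i in [set i : 'I_K | (r <= i)%N])
    [set w | (count_ge (fun k => f k w) (ebh_threshold K alpha i.+1) <= i)%N]).
  apply: fin_bigcap_measurable => [|i _]; first exact: finite_finset.
  exact: measurable_count_ge.
apply/seteqP; split => w /= => [/(ebh_kstar_leP _ _ _ a0) h i /= /h//|h].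
by apply/(ebh_kstar_leP _ _ _ a0) => i /h.
Qed.

End eBH_combinatorics.

(** * Upper sets of the extended real line *)

Section upper_sets.
Context {R : realType}.
Implicit Types (U V : set (\bar R)).

Definition upper_set U := forall x y, U x -> (x <= y)%E -> U y.

(** The endpoint is the infimum, and the ray is closed or open according to whether it is attained.
    The empty set is the open ray from +oo. *)
Lemma upper_set_ray U : upper_set U ->
  exists m, U = [set e | (m <= e)%E] \/ U = [set e | (m < e)%E].
Proof.
move=> upU; exists (ereal_inf U); have [Um|nUm] := pselect (U (ereal_inf U)).
  left; apply/seteqP; split => e /= => [|/(upU _ _ Um)//].
  exact: ereal_inf_lbound.
right; apply/seteqP; split => e /= => [Ue|/ereal_inf_lt[x Ux /ltW]].
  rewrite lt_neqAle ereal_inf_lbound// andbT.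
  by apply: contra_notN nUm => /eqP ->.
exact: upU.
Qed.

Lemma measurable_upper_set U : upper_set U -> measurable U.
Proof.
move=> /upper_set_ray[m [->|->]].
- by have := emeasurable_itv `[m, +oo[; rewrite set_itvE.
- by have := emeasurable_itv `]m, +oo[; rewrite set_itvE.
Qed.

(** PRDS speaks only of the events [x%:E <= X k w] with real [x >= 0]; these thresholds reach other
    upper sets as pointwise limits on [0, +oo]. Containing +oo excludes the empty set. *)
Lemma upper_set_approx U : upper_set U -> U +oo%E ->
  exists x : nat -> R, (forall n, 0 <= x n) /\
    forall e, (0 <= e)%E -> \forall n \near \oo, ((x n)%:E <= e)%E <-> U e.
Proof.
move=> /upper_set_ray[m [->|->]] /=.
- case: m => [m _|_|_].
  + exists (fun=> Num.max m 0); split=> [n|e e0]; first by rewrite le_max lexx orbT.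
    by near=> n; rewrite EFin_max ge_max e0 andbT.
  (* Here [U] contains only +oo, and the thresholds must leave every bounded set. *)
  + exists (fun n => n%:R); split=> // -[e e0|_|//].
    * near=> n; split=> //=; rewrite lee_fin leNgt => /negP; case.
      by near: n; exact: nbhs_infty_gtr.
    * by near=> n; rewrite !leey.
  + exists (fun=> 0); split=> // e e0.
    by near=> n; rewrite leNye e0.
- case: m => [m _|//|_].
  + have [m0|m0] := ltP m 0.
      exists (fun=> 0); split=> // e e0.
      by near=> n; rewrite e0 (lt_le_trans _ e0)// lte_fin.
    (* An open ray is the increasing union of the closed rays that start slightly above [m]. *)
    exists (fun n => m + n.+1%:R^-1); split=> [n|e e0]; first by rewrite addr_ge0.
    case: e e0 => [e e0|_|//]; last by near=> n; rewrite leey ltry.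
    have [me|em] := ltP m e.
      near=> n; rewrite lte_fin me lee_fin; split=> // _.
      rewrite -lerBrDl ltW//; near: n.
      have em0 : 0 < e - m by rewrite subr_gt0.
      exact: (near_infty_natSinv_lt (PosNum em0)).
    near=> n; rewrite lte_fin ltNge em lee_fin; split=> //.
    by rewrite leNgt (le_lt_trans em)// ltrDl.
  + exists (fun=> 0); split=> // e e0.
    by near=> n; rewrite e0 (lt_le_trans _ e0)// ltNy0.
Unshelve. all: by end_near. Qed.

End upper_sets.

(** * Real-valued probabilities: limits and expectations *)

Section probability_real.
Context d (T : measurableType d) (R : realType) (P : probability T R).
Implicit Types (A B : set T).

Lemma fine_probability_ge0 A : 0 <= fine (P A).
Proof. exact: fine_ge0. Qed.

Lemma le_fine_probability A B : measurable A -> measurable B -> A `<=` B ->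
  fine (P A) <= fine (P B).
Proof.
move=> mA mB AB; apply: fine_le; rewrite ?fin_num_measure//.
by apply: le_measure; rewrite ?inE.
Qed.

(** Dominated convergence for indicators, with the constant 1 as bound; the rank from which
    memberships agree may depend on [w]. *)
Lemma cvg_probability (A_ : nat -> set T) A :
  (forall n, measurable (A_ n)) -> measurable A ->
  (forall w, \forall n \near \oo, A_ n w <-> A w) ->
  fine (P (A_ n)) @[n --> \oo] --> fine (P A).
Proof.
move=> mA_ mA A_A; apply: fine_cvg; rewrite fineK ?fin_num_measure//.
have PE B : measurable B -> P B = (\int[P]_w (\1_B w)%:E)%E.
  by move=> mB; rewrite integral_indic// setIT.
rewrite PE//; under eq_cvg do rewrite PE//.
apply: (@dominated_cvg _ _ _ P setT measurableT _ _ (cst 1%E)) => //.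
- by move=> n; apply/measurable_EFinP/measurable_indic.
- move=> w _; apply: cvg_near_cst; apply: filterS (A_A w) => n AnA.
  congr (_%:E); rewrite !indicE; congr (_%:R); congr nat_of_bool.
  by apply/idP/idP; rewrite !inE; case: AnA.
- exact: finite_measure_integrable_cst.
- by move=> n w _; rewrite /= indicE; case: (_ \in _); rewrite ?normr1 ?normr0.
Qed.

Lemma expectation_sum_indic (I : Type) (s : seq I) (Q : pred I) (c : I -> R)
    (A : I -> set T) :
  (forall i, 0 <= c i) -> (forall i, measurable (A i)) ->
  ('E_P[fun w => (\sum_(i <- s | Q i) c i * \1_(A i) w)%R])%E =
  (\sum_(i <- s | Q i) c i * fine (P (A i)))%:E.
Proof.
move=> c0 mA; rewrite unlock -big_filter -sumEFin.
under eq_integral do rewrite -big_filter -sumEFin.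
rewrite ge0_integral_sum//.
- apply: eq_bigr => i _; rewrite EFinM fineK ?fin_num_measure//.
  under eq_integral do rewrite EFinM.
  rewrite ge0_integralZl//; first by rewrite integral_indic// setIT.
  + exact/measurable_EFinP/measurable_indic.
  + by rewrite lee_fin.
- by move=> i; apply/measurable_EFinP/measurable_funM => //; exact: measurable_indic.
- by move=> i w _; rewrite lee_fin mulr_ge0.
Qed.

End probability_real.

(** In the induction, the bound [c n.+1 n.+1] on the earlier terms is at most [c n.+2 n.+1], which
    the new term subtracts. *)
Lemma le_telescope (R : numDomainType) (c : nat -> nat -> R) (n : nat) :
  0 <= c 1%N 0%N -> (forall r s, (0 < r)%N -> c r s <= c r.+1 s) ->
  \sum_(i < n.+1) (c i.+1 i.+1 - c i.+1 i) <= c n.+1 n.+1.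
Proof.
move=> c0 cS; elim: n => [|n IHn]; first by rewrite big_ord1 gerBl.
rewrite big_ord_recr /= addrCA gerDl subr_le0.
exact: le_trans IHn (cS _ _ _).
Qed.

(** * PRDS for conditioning on arbitrary upper sets *)

Section PRDS_theory.
Context d (T : measurableType d) (R : realType) (P : probability T R) (K : nat).
Variables (N : {set 'I_K}) (E : 'I_K -> T -> \bar R).
Hypotheses (mE : forall k, measurable_fun setT (E k))
  (E_ge0 : forall k w, (0 <= E k w)%E) (E_prds : PRDS P N E).

Lemma measurable_event_upper_set (k : 'I_K) (U : set (\bar R)) : upper_set U ->
  measurable [set w | U (E k w)].
Proof.
move=> /measurable_upper_set mU; rewrite -[X in measurable X]setTI; exact: mE.
Qed.

Lemma measurable_event_tuple (A : set (K.-tuple (\bar R))) : measurable A ->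
  measurable [set w | A [tuple E i w | i < K]].
Proof.
move=> mA.
have mtup : measurable_fun setT (fun w => [tuple E i w | i < K]).
  apply/measurable_fun_tnthP => i.
  rewrite (_ : _ \o _ = E i)//; apply/funext => w /=; exact: tnth_mktuple.
rewrite -[X in measurable X]setTI; exact: mtup.
Qed.

(** Both conditioning events are limits of events [E k w >= x], for which PRDS gives the inequality.
    It serves for transformed e-values, whose threshold events may be open rays in [E k]. *)
Lemma PRDS_upper_set (k : 'I_K) (A : set (K.-tuple (\bar R)))
    (U V : set (\bar R)) :
  k \in N -> measurable A -> decreasing_set A ->
  upper_set U -> upper_set V -> V `<=` U ->
  cond_prob P [set w | A [tuple E i w | i < K]] [set w | V (E k w)] <=
  cond_prob P [set w | A [tuple E i w | i < K]] [set w | U (E k w)].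
Proof.
move=> kN mA decA upU upV VU; set D := [set w | A _].
have mD : measurable D by exact: measurable_event_tuple.
pose ev (W : set (\bar R)) := [set w | W (E k w)].
rewrite -/(ev U) -/(ev V).
have mU : measurable (ev U) by exact: measurable_event_upper_set.
have mV : measurable (ev V) by exact: measurable_event_upper_set.
have [PV0|PV_neq0] := eqVneq (fine (P (ev V))) 0.
  by rewrite /cond_prob PV0 invr0 mulr0 divr_ge0// fine_probability_ge0.
have PV_gt0 : 0 < fine (P (ev V)) by rewrite lt_neqAle eq_sym PV_neq0 fine_probability_ge0.
have PU_gt0 : 0 < fine (P (ev U)).
  by apply: lt_le_trans PV_gt0 _; apply: le_fine_probability => // w; exact: VU.
(* An upper set without +oo is empty, so its event would have probability 0. *)
have Voo : V +oo%E.
  apply: contra_neqP PV_neq0 => nVoo; rewrite (_ : ev V = set0) ?measure0//.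
  by apply/seteqP; split => w //= Vw; apply: nVoo; apply: upV Vw (leey _).
have [v [v0 vV]] := upper_set_approx _ upV Voo.
have [u [u0 uU]] := upper_set_approx _ upU (VU _ Voo).
pose ge (x : R) := [set w | (x%:E <= E k w)%E].
have mge x : measurable (ge x).
  by apply: (@measurable_event_upper_set k [set e | (x%:E <= e)%E]) => ? ?; exact: le_trans.
(* Replacing u by min(u, v) keeps the limit, since V is included in U. *)
pose m n := Num.min (u n) (v n).
have mU_ w : \forall n \near \oo, ge (m n) w <-> ev U w.
  near=> n.
  have [un Un] : ((u n)%:E <= E k w)%E <-> U (E k w) by near: n; exact: uU.
  have [vn Vn] : ((v n)%:E <= E k w)%E <-> V (E k w) by near: n; exact: vV.
  rewrite /ge /m /ev /= EFin_min ge_min; split=> [/orP[/un//|/vn/VU//]|/Un ->//].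
(* Cross-multiplied, the inequality survives a vanishing [P (ge (v n))] and passes to the limit
   through products. *)
have cond_le n : fine (P (D `&` ge (v n))) * fine (P (ge (m n))) <=
    fine (P (D `&` ge (m n))) * fine (P (ge (v n))).
  have mv : m n <= v n by rewrite ge_min lexx orbT.
  have m0 : 0 <= m n by rewrite le_min u0 v0.
  have [Pv0|Pv_neq0] := eqVneq (fine (P (ge (v n)))) 0.
    rewrite (_ : fine (P (D `&` _)) = 0) ?mul0r ?mulr_ge0 ?fine_probability_ge0//.
    apply/eqP; rewrite eq_le fine_probability_ge0 -Pv0 andbT.
    by apply: le_fine_probability => //; exact: measurableI.
  have Pv_gt0 : 0 < fine (P (ge (v n))).
    by rewrite lt_neqAle eq_sym Pv_neq0 fine_probability_ge0.
  have Pm_gt0 : 0 < fine (P (ge (m n))).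
    apply: lt_le_trans Pv_gt0 _; apply: le_fine_probability => // w.
    by apply: le_trans; rewrite lee_fin.
  have := E_prds _ kN _ mA decA _ _ m0 mv; rewrite /cond_prob -/D -/(ge _) -/(ge (m n)).
  by rewrite ler_pdivrMr// mulrAC ler_pdivlMr.
have lim_le : fine (P (D `&` ev V)) * fine (P (ev U)) <=
    fine (P (D `&` ev U)) * fine (P (ev V)).
  have cvgI (A_ : nat -> set T) B : (forall n, measurable (A_ n)) -> measurable B ->
      (forall w, \forall n \near \oo, A_ n w <-> B w) ->
      fine (P (D `&` A_ n)) @[n --> \oo] --> fine (P (D `&` B)).
    move=> mA_ mB A_B; apply: cvg_probability => [n||w]; try exact: measurableI.
    by apply: filterS (A_B w) => n [AB BA]; split=> -[Dw ?]; split=> //; [exact: AB|exact: BA].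
  have mU_m := cvg_probability _ _ _ P _ _ (fun n => mge (m n)) mU mU_.
  have mV_v := cvg_probability _ _ _ P _ _ (fun n => mge (v n)) mV (fun w => vV _ (E_ge0 k w)).
  have mDU_m := cvgI _ _ (fun n => mge (m n)) mU mU_.
  have mDV_v := cvgI _ _ (fun n => mge (v n)) mV (fun w => vV _ (E_ge0 k w)).
  apply: (ler_cvg_to (cvgM mDV_v mU_m) (cvgM mDU_m mV_v)).
  by near=> n; exact: cond_le.
by rewrite /cond_prob ler_pdivrMr// mulrAC ler_pdivlMr.
Unshelve. all: by end_near. Qed.

(** * The false discovery rate bound for increasing transforms of PRDS e-values *)

Section ebh_fdr.
Variables (alpha : R) (phi : 'I_K -> \bar R -> \bar R).
Hypotheses (alpha_gt0 : 0 < alpha) (phi_incr : forall k, increasing_nneg (phi k)).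
Let X k w := phi k (E k w).
Let G k r := [set w | ((ebh_threshold K alpha r)%:E <= X k w)%E].
Let D r := [set w | (ebh_kstar alpha (fun k => X k w) <= r)%N].

(* [phi k] is only monotone on [0, +oo]; precomposing it with the positive part
   makes it monotone on the whole of [\bar R]. *)
Let phi_pos k (e : \bar R) := phi k (maxe 0%E e).

Let phi_pos_le k : {homo phi_pos k : x y / (x <= y)%E}.
Proof.
move=> x y xy; apply: (phi_incr k).2; first by rewrite le_max lexx.
by rewrite ge_max !le_max lexx xy orbT.
Qed.

Let phi_posE k w : phi_pos k (E k w) = X k w.
Proof. by rewrite /phi_pos max_r. Qed.

Let upper_set_phi_pos k (c : R) : upper_set [set e | (c%:E <= phi_pos k e)%E].
Proof. by move=> x y /= cx xy; exact: le_trans cx (phi_pos_le k _ _ xy). Qed.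

Let ge_event k (c : R) :
  [set w | (c%:E <= X k w)%E] = [set w | [set e | (c%:E <= phi_pos k e)%E] (E k w)].
Proof. by apply/seteqP; split => w /=; rewrite phi_posE. Qed.

Let measurable_ge k (c : R) : measurable [set w | (c%:E <= X k w)%E].
Proof. by rewrite ge_event; exact: measurable_event_upper_set. Qed.

Let measurable_G k r : measurable (G k r). Proof. exact: measurable_ge. Qed.

Let measurable_D r : measurable (D r).
Proof. exact: measurable_ebh_kstar_le. Qed.

(** PRDS enters here: [D s] is the preimage of a decreasing set of raw e-values, and [G k r] is
    included in [G k r.+1] because the threshold decreases. *)
Lemma cond_prob_ebh_le k (r s : nat) : k \in N -> (0 < r)%N ->
  cond_prob P (D s) (G k r) <= cond_prob P (D s) (G k r.+1).
Proof.
move=> kN r0; pose A := [set x : K.-tuple (\bar R) |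
  (ebh_kstar alpha (fun i => phi_pos i (tnth x i)) <= s)%N].
have mA : measurable A.
  apply: measurable_ebh_kstar_le => // i c.
  have := measurable_tnth i measurableT (measurable_upper_set _ (upper_set_phi_pos i c)).
  by rewrite setTI.
have decA : decreasing_set A.
  move=> x y Ax yx; apply: leq_trans Ax; apply: le_ebh_kstar => // i.
  exact: phi_pos_le.
have tnthE w : (fun i => phi_pos i (tnth [tuple E i w | i < K] i)) = (fun i => X i w).
  by apply/funext => i; rewrite tnth_mktuple phi_posE.
have -> : D s = [set w | A [tuple E i w | i < K]].
  by apply/funext => w; rewrite /D /A /mkset tnthE.
rewrite /G !ge_event; apply: PRDS_upper_set => // e /=.
by apply: le_trans; rewrite lee_fin le_ebh_threshold.
Qed.

Let kstar_event r : [set w | ebh_kstar alpha (fun k => X k w) = r.+1] = D r.+1 `\` D r.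
Proof.
apply/seteqP; split => w /=; rewrite /D /=.
  by move=> ->; rewrite ltnn leqnn.
by move=> [le_r /negP]; rewrite -ltnNge => lt_r; apply/eqP; rewrite eqn_leq le_r.
Qed.

(** Hypothesis [k] is rejected and there are [r.+1] rejections in all; the shift matches ordinal
    indices. *)
Let hit k r := G k r.+1 `&` [set w | ebh_kstar alpha (fun k => X k w) = r.+1].

Let measurable_hit k r : measurable (hit k r).
Proof. by rewrite /hit kstar_event; apply: measurableI => //; exact: measurableD. Qed.

(** Inside [G k r.+1], the event [D r.+1] is the disjoint union of [D r] and [hit k r]. *)
Lemma cond_prob_hit k r :
  cond_prob P (D r.+1) (G k r.+1) - cond_prob P (D r) (G k r.+1) =
  fine (P (hit k r)) / fine (P (G k r.+1)).
Proof.
rewrite /cond_prob -mulrBl; congr (_ / _); apply/eqP; rewrite subr_eq addrC; apply/eqP.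
have mDG s : measurable (D s `&` G k r.+1) by exact: measurableI.
rewrite -fineD ?fin_num_measure//; congr fine; rewrite -measureU//; last first.
  by rewrite /hit kstar_event; apply/seteqP; split => w //= [[Dw _] [_ [_]]].
congr (P _); rewrite /hit kstar_event; apply/seteqP; split => w /=.
  by move=> [Dw Gw]; have [|] := pselect (D r w); [left|right].
move=> [[Dw Gw]|[Gw [Dw _]]]; split=> //; exact: leqW Dw.
Qed.

Lemma ebh_null_bound k : k \in N ->
  \sum_(i < K) i.+1%:R^-1 * fine (P (hit k i)) <= max_tail K P alpha (X k) / K%:R.
Proof.
move=> kN; set M := max_tail _ _ _ _.
have K_gt0 : (0 < K)%N by exact: leq_ltn_trans (ltn_ord k).
have M_ge (i : 'I_K) : K%:R / i.+1%:R * fine (P (G k i.+1)) <= M.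
  rewrite /M /max_tail; apply: le_trans (le_bigmax _ _ i).
  by under eq_set => w do rewrite -le_ebh_threshold_mul//.
have M0 : 0 <= M by apply: le_trans (M_ge (Ordinal K_gt0)); rewrite mulr_ge0 ?fine_probability_ge0.
pose c r s := cond_prob P (D s) (G k r).
have term_le (i : 'I_K) :
    i.+1%:R^-1 * fine (P (hit k i)) <= M / K%:R * (c i.+1 i.+1 - c i.+1 i).
  rewrite cond_prob_hit; have [PG0|PG_neq0] := eqVneq (fine (P (G k i.+1))) 0.
    rewrite (_ : fine (P (hit k i)) = 0) ?mul0r ?mulr0//.
    apply/eqP; rewrite eq_le fine_probability_ge0 andbT -PG0.
    by apply: le_fine_probability => //; exact: subIsetl.
  (* With the common factor [fine (P (hit k i))] removed, what remains is a rearrangement of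
     [M_ge i]. *)
  rewrite [leLHS]mulrC [leRHS]mulrCA ler_wpM2l ?fine_probability_ge0//.
  rewrite ler_pdivlMr ?lt_neqAle 1?eq_sym ?PG_neq0 ?fine_probability_ge0//.
  by rewrite ler_pdivlMr ?ltr0n// mulrC mulrA.
apply: le_trans (ler_sum _ (fun i _ => term_le i)) _.
rewrite -mulr_sumr ler_piMr ?divr_ge0//.
have c_ge0 r s : 0 <= c r s by rewrite divr_ge0 ?fine_probability_ge0.
(* There are [K] terms, whence [K.-1]. The sum is bounded by [c K K], a conditional probability,
   which is at most 1 (or 0 by the division convention). *)
have := le_telescope _ c K.-1 (c_ge0 _ _) (fun r s r0 => cond_prob_ebh_le k r s kN r0).
rewrite prednK// => /le_trans; apply; rewrite /c /cond_prob.
have [->|PG_neq0] := eqVneq (fine (P (G k K))) 0; first by rewrite invr0 mulr0.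
rewrite ler_pdivrMr ?lt_neqAle 1?eq_sym ?PG_neq0 ?fine_probability_ge0// mul1r.
by apply: le_fine_probability => //; exact: measurableI.
Qed.

Lemma ebh_fdr_le :
  ('E_P[fun w => ebh_fdp N alpha (fun k => X k w)] <=
    (#|N|%:R / K%:R * z_alpha P N alpha X)%:E)%E.
Proof.
(* As one sum of weighted indicators over pairs, the FDP has an expectation given by linearity. *)
have -> : (fun w => ebh_fdp N alpha (fun k => X k w)) =
    (fun w => \sum_(p : 'I_K * 'I_K | p.1 \in N) p.2.+1%:R^-1 * \1_(hit p.1 p.2) w).
  apply/funext => w; rewrite ebh_fdpE// pair_big /=; apply: eq_big => [p|p _].
    by rewrite andbT.
  rewrite indicE; congr (_ * _%:R); congr nat_of_bool; apply/idP/idP.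
    by move=> /andP[/eqP kstarE Xp]; rewrite inE.
  by rewrite inE => -[Xp /= ->]; rewrite eqxx.
rewrite expectation_sum_indic//.
rewrite lee_fin /z_alpha; set S := \sum_(k in N) _.
(* The cardinal of [N] cancels if it is nonzero; otherwise [S] is an empty sum and both sides are
   0. *)
have -> : #|N|%:R / K%:R * (#|N|%:R^-1 * S) = S / K%:R.
  have [N0|N_neq0] := eqVneq (#|N|%:R : R) 0; last first.
    by rewrite mulrACA mulrA mulfV// mul1r mulrC.
  move: N0 => /eqP; rewrite pnatr_eq0 cards_eq0 => /eqP N0.
  by rewrite /S N0 big_set0 cards0 !mul0r.
rewrite (eq_bigl (fun p : 'I_K * 'I_K => (p.1 \in N) && true)); last first.
  by move=> p; rewrite andbT.
rewrite -(pair_big (mem N) xpredT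
  (fun k i : 'I_K => i.+1%:R^-1 * fine (P (hit k i)))) /=.
rewrite /S mulr_suml; apply: ler_sum => k; exact: ebh_null_bound.
Qed.

End ebh_fdr.

End PRDS_theory.

(** Each x = K/r equals [alpha] times the threshold c = t_r, and Markov's inequality bounds c P(X >=
    c) by the expectation of X, hence by 1. *)
Lemma markov_max_tail d (T : measurableType d) (R : realType)
    (P : probability T R) (K : nat) (alpha : R) (X : T -> \bar R) :
  0 < alpha -> measurable_fun setT X -> (forall w, (0 <= X w)%E) ->
  (\int[P]_w X w <= 1)%E -> max_tail K P alpha X <= alpha.
Proof.
move=> a0 mX X0 X1; apply: bigmax_le => [|i _]; first exact: ltW.
have K0 : (0 : R) < K%:R by rewrite ltr0n (leq_ltn_trans _ (ltn_ord i)).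
under eq_set => w do rewrite -le_ebh_threshold_mul//.
set c := ebh_threshold _ _ _.
have -> : K%:R / i.+1%:R = c * alpha by rewrite divfK// lt0r_neq0.
have c0 : 0 < c by rewrite !divr_gt0.
have mc : measurable [set w | (c%:E <= X w)%E].
  by have := emeasurable_fun_c_infty measurableT mX c%:E; rewrite setTI.
rewrite mulrAC; apply: ler_piMl; first exact: ltW.
rewrite -lee_fin EFinM fineK ?fin_num_measure//.
apply: le_trans X1; rewrite (_ : [set w | _] = setT `&` [set w | (c%:E <= `|X w|)%E]).
  rewrite [leRHS](_ : _ = \int[P]_w id `|X w|)%E; last first.
    by apply: eq_integral => w _; rewrite gee0_abs.
  apply: (@le_integral_comp_abse _ _ _ P setT measurableT X c id) => //.
by rewrite setTI; apply: eq_set => w; rewrite gee0_abs.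
Qed.

Theorem theorem4 (d : measure_display) (T : measurableType d) (R : realType)
  (P : probability T R) (K : nat) (hK : (1 <= K)%N)
  (H : 'I_K -> set (probability T R))
  (N : {set 'I_K}) (hN : forall k, k \in N <-> H k P)
  (alpha : R) (halpha0 : 0 < alpha) (halpha1 : alpha < 1)
  (E : 'I_K -> T -> \bar R)
  (mE : forall k, measurable_fun setT (E k))
  (E_ge0 : forall k w, (0 <= E k w)%E)
  (E_null : forall k, k \in N -> (\int[P]_w E k w <= 1)%E)
  (E_prds : PRDS P N E) :
  (forall E' : 'I_K -> T -> \bar R,
     (forall k, measurable_fun setT (E' k)) ->
     (forall k w, (0 <= E' k w)%E) ->
     (PRDS P N E' \/ increasing_transform E E') ->
     ('E_P[fun w => ebh_fdp N alpha (fun k => E' k w)] <=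
       (#|N|%:R / K%:R * z_alpha P N alpha E')%:E)%E)
  /\
  (forall E' : 'I_K -> T -> \bar R,
     (E' = E \/ boosted_by_factors H alpha E E' \/
      boosted_by_functions H alpha E E') ->
     z_alpha P N alpha E' <= alpha).
Proof.
split=> [E' mE' E'_ge0 [E'_prds|[phi [phi_incr E'E]]]|E' E'_cases].
(* When the inputs are themselves PRDS, they serve as raw e-values with the identity as
   transform. *)
- by apply: (ebh_fdr_le _ _ _ P K N E' mE' E'_ge0 E'_prds alpha (fun=> id)).
- have -> : E' = (fun k w => phi k (E k w)).
    by apply/funext => k; apply/funext => w.
  exact: ebh_fdr_le.
(* Raw e-values satisfy this by Markov's inequality. For boosted ones, the boosting condition is
   applied to [P], which belongs to [H k] for a true null. *)
have tail_le k : k \in N -> max_tail K P alpha (E' k) <= alpha.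
  move=> kN; case: E'_cases => [->|[[_ bc]|[_ bc]]].
  - exact: markov_max_tail (E_null k kN).
  - exact/bc/hN.
  - exact/bc/hN.
(* Without true nulls the average is 0 by the division convention. *)
rewrite /z_alpha; have [->|N_neq0] := eqVneq #|N| 0%N.
  by rewrite invr0 mul0r ltW.
rewrite ler_pdivrMl ?ltr0n ?lt0n//; apply: le_trans (ler_sum _ tail_le) _.
by rewrite sumr_const mulr_natl.
Qed.
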